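(* Let $\mathbb K$ be $\mathbb R$ or $\mathbb C$ and let $\mathfrak g$ be the three-dimensional Lie algebra over $\mathbb K$ with basis $\eta_1,\eta_2,\eta_3$ and non-zero brackets $[\eta_1,\eta_2]=\eta_2$, $[\eta_3,\eta_1]=-\eta_3$. Then every basis of $\mathfrak g$ is a Nijenhuis eigenbasis, but not all bases are equivalent to each other: there exist two Nijenhuis eigenbases $\zeta_1,\zeta_2,\zeta_3$ and $\zeta_1',\zeta_2',\zeta_3'$ of $\mathfrak g$ that cannot be taken one to the other by an automorphism of $\mathfrak g$ and multiplication of the basis vectors by non-zero constants. Consequently, there exist regular semisimple algebraic Nijenhuis operators on $\mathfrak g$ that are not equivalent.
   Context: A Nijenhuis eigenbasis of a finite-dimensional Lie algebra $\mathfrak g$ is a basis $\zeta_1,\dots,\zeta_n$ of $\mathfrak g$ such that $[\zeta_i,\zeta_j]$ lies in the linear span of $\zeta_i$ and $\zeta_j$ for all $i,j$. An algebraic Nijenhuis operator on $\mathfrak g$ is a linear operator $L:\mathfrak g\to\mathfrak g$ such that $L[L\xi,\eta]+L[\xi,L\eta]-[L\xi,L\eta]-L^2[\xi,\eta]=0$ for all $\xi,\eta\in\mathfrak g$. It is regular semisimple if it is diagonalizable over $\mathbb K$ with pairwise different eigenvalues; any eigenbasis of a regular semisimple algebraic Nijenhuis operator is a Nijenhuis eigenbasis, and conversely any operator that is diagonal with pairwise distinct eigenvalues in a Nijenhuis eigenbasis is a regular semisimple algebraic Nijenhuis operator. Two regular semisimple algebraic Nijenhuis operators $L$ and $L'$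 on a three-dimensional Lie algebra $\mathfrak g$ are called equivalent if they have eigenbases $\zeta_1,\zeta_2,\zeta_3$ (of $L$) and $\zeta_1',\zeta_2',\zeta_3'$ (of $L'$) such that $\zeta_i'=\mu_i\Phi(\zeta_i)$, $i=1,2,3$, for some non-zero constants $\mu_i\in\mathbb K$ and some Lie algebra automorphism $\Phi:\mathfrak g\to\mathfrak g$ (the eigenvalues are disregarded). Two Nijenhuis eigenbases are called equivalent if they are related in this way. *)

(* Defs.v *)
From HB Require Import structures.
From mathcomp Require Import all_boot all_order all_algebra all_fingroup.
From mathcomp Require Import reals complex.

Set Implicit Arguments.
Unset Strict Implicit.
Unset Printing Implicit Defensive.

Import GRing.Theory.
Local Open Scope ring_scope.

(* [K] is the field of real numbers or of complex numbers; as usual, the reals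
   are given by an arbitrary complete Archimedean ordered field [R]. *)
Inductive real_or_complex (R : realType) : fieldType -> Prop :=
| RealScalars : real_or_complex R R
| ComplexScalars : real_or_complex R (complex R).

HB.mixin Record Vector_isLie (K : fieldType) (V : Type) of Vector K V := {
  lie : V -> V -> V;
  lie_linearl : forall y : V, linear (fun x => lie x y);
  lie_linearr : forall x : V, linear (lie x);
  liexx : forall x : V, lie x x = 0;
  lie_jacobi : forall x y z : V,
    lie x (lie y z) + lie y (lie z x) + lie z (lie x y) = 0
}.

#[short(type="lieAlgType")]
HB.structure Definition LieAlgebra (K : fieldType) :=
  {V of Vector K V & Vector_isLie K V}.

Notation "[ 'lie' x , y ]" := (lie x y)
  (at level 0, x, y at level 99, format "[ 'lie'  x ,  y ]") : ring_scope.

Section Nijenhuis.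
Variables (K : fieldType) (g : lieAlgType K).

Definition nijenhuis_eigenbasis (n : nat) (z : n.-tuple g) : Prop :=
  basis_of fullv z /\
  forall i j : 'I_n,
    [lie tnth z i, tnth z j] \in <<[:: tnth z i; tnth z j]>>%VS.

Definition lie_automorphism (f : 'End(g)) : Prop :=
  bijective f /\ forall x y : g, f [lie x, y] = [lie f x, f y].

(* Equivalence of bases, with the given orderings of their vectors. *)
Definition basis_equivalent (n : nat) (z z' : n.-tuple g) : Prop :=
  exists (f : 'End(g)) (mu : 'I_n -> K),
    [/\ lie_automorphism f, forall i, mu i != 0
      & forall i, tnth z' i = mu i *: f (tnth z i)].

Definition algebraic_nijenhuis (L : 'End(g)) : Prop :=
  forall x y : g,
    L [lie L x, y] + L [lie x, L y] - [lie L x, L y] - L (L [lie x, y]) = 0.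

Definition eigenbasis (L : 'End(g)) (n : nat) (z : n.-tuple g) : Prop :=
  basis_of fullv z /\ forall i, exists a : K, L (tnth z i) = a *: tnth z i.

Definition regular_semisimple (L : 'End(g)) : Prop :=
  exists (z : (\dim {:g}).-tuple g) (a : 'I_(\dim {:g}) -> K),
    [/\ basis_of fullv z, injective a
      & forall i, L (tnth z i) = a i *: tnth z i].

Definition operator_equivalent (L L' : 'End(g)) : Prop :=
  exists z z' : (\dim {:g}).-tuple g,
    [/\ eigenbasis L z, eigenbasis L' z' & basis_equivalent z z'].

End Nijenhuis.

(* Main.v *)
Require Import Defs.
From HB Require Import structures.
From mathcomp Require Import all_boot all_order all_algebra all_fingroup.
From mathcomp Require Import reals complex.

Set Implicit Arguments.
Unset Strict Implicit.
Unset Printing Implicit Defensive.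

Import GRing.Theory.
Local Open Scope ring_scope.

(** The bracket has the form [x, y] = phi(x) y - phi(y) x, where the linear form
   phi is the first coordinate in the basis eta.  Hence every basis is a Nijenhuis
   eigenbasis and every endomorphism is a Nijenhuis operator.  Since the derived
   algebra is the kernel of phi, automorphisms preserve this kernel, so the number
   of basis vectors lying in it is invariant under equivalence.  This number is 2
   for (eta1, eta2, eta3) and 0 for (eta1, eta2 + eta1, eta3 + eta1). *)

Lemma lieDl (K : fieldType) (g : lieAlgType K) (x y z : g) :
  [lie x + y, z] = [lie x, z] + [lie y, z].
Proof. by have := lie_linearl z 1 x y; rewrite !scale1r. Qed.

Lemma lieDr (K : fieldType) (g : lieAlgType K) (x y z : g) :
  [lie x, y + z] = [lie x, y] + [lie x, z].
Proof. by have := lie_linearr x 1 y z; rewrite !scale1r. Qed.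

Lemma lie0r (K : fieldType) (g : lieAlgType K) (x : g) : [lie x, 0] = 0.
Proof. by apply: (addrI [lie x, 0]); rewrite -lieDr !addr0. Qed.

Lemma lie0l (K : fieldType) (g : lieAlgType K) (x : g) : [lie 0, x] = 0.
Proof. by apply: (addrI [lie 0, x]); rewrite -lieDl !addr0. Qed.

Lemma lieZl (K : fieldType) (g : lieAlgType K) (a : K) (x y : g) :
  [lie a *: x, y] = a *: [lie x, y].
Proof. by have := lie_linearl y a x 0; rewrite lie0l !addr0. Qed.

Lemma lieZr (K : fieldType) (g : lieAlgType K) (a : K) (x y : g) :
  [lie x, a *: y] = a *: [lie x, y].
Proof. by have := lie_linearr x a y 0; rewrite lie0r !addr0. Qed.

Definition scalar_lie (K : fieldType) (g : lieAlgType K) (phi : {scalar g}) :=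
  forall x y : g, [lie x, y] = phi x *: y - phi y *: x.

Section ScalarLie.
Variables (K : fieldType) (g : lieAlgType K) (phi : {scalar g}).
Hypothesis lieE : scalar_lie phi.

Lemma scalar_lie_eigenbasis (n : nat) (z : n.-tuple g) :
  basis_of fullv z -> nijenhuis_eigenbasis z.
Proof.
move=> zB; split=> // i j; rewrite lieE.
by rewrite memvB ?memvZ // memv_span // !inE eqxx ?orbT.
Qed.

Lemma scalar_lie_nijenhuis (L : 'End(g)) : algebraic_nijenhuis L.
Proof.
move=> x y; rewrite !lieE !(linearB L) !(linearZ_LR L).
(* The first two terms and the last two expand to the same four vectors: [phi (L x) *: L y],
   [phi x *: L (L y)] and the negatives of the two with [x] and [y] swapped. *)
by rewrite -addrA -opprD addrACA [X in _ - X]addrACA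
  [X in _ - (_ + X)]addrC subrr.
Qed.

(** [phi] vanishes on brackets, while [phi x = 0] gives [[lie f x, x] = phi (f x) *: x]. Applying
    [f] and then [phi] yields [phi (f x) ^+ 2 = 0]. *)
Lemma automorphism_scalar_eq0 (f : 'End(g)) (x : g) :
  lie_automorphism f -> phi x = 0 -> phi (f x) = 0.
Proof.
move=> [_ fL] x0; apply/eqP/negP => /negP fx0.
have : phi (f [lie f x, x]) = 0.
  by rewrite fL lieE linearB !linearZ /= mulrC subrr.
rewrite lieE x0 scale0r subr0 !linearZ /= => /eqP.
by rewrite mulf_eq0 orbb (negPf fx0).
Qed.

Lemma basis_equivalent_scalar_eq0 (n : nat) (z z' : n.-tuple g) (i : 'I_n) :
  basis_equivalent z z' -> phi (tnth z i) = 0 -> phi (tnth z' i) = 0.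
Proof.
move=> [f [mu [fA _ ->]]] zi0.
by rewrite linearZ /= (automorphism_scalar_eq0 fA zi0) mulr0.
Qed.

End ScalarLie.

Section Diagonal.
Variables (K : fieldType) (g : lieAlgType K).

Lemma diagonal_operator_exists (n : nat) (z : n.-tuple g) (a : 'I_n -> K) :
  basis_of fullv z ->
  exists L : 'End(g), forall i, L (tnth z i) = a i *: tnth z i.
Proof.
move=> zB; pose us := [tuple a i *: tnth z i | i < n].
have [f fE] := linear_of_free z us.
have {}fE := fE (basis_free zB) (etrans (size_tuple us) (esym (size_tuple z))).
exists (linfun f) => i; have := congr1 (fun s => nth 0 s i) fE.
by rewrite (nth_map 0) ?size_tuple // -!tnth_nth tnth_mktuple lfunE.
Qed.

Lemma diagonal_regular_semisimple (n : nat) (L : 'End(g)) (z : n.-tuple g)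
    (a : 'I_n -> K) :
  basis_of fullv z -> injective a ->
  (forall i, L (tnth z i) = a i *: tnth z i) -> regular_semisimple L.
Proof.
move=> zB aI LE.
have nE : n = \dim {:g} by rewrite (size_basis zB).
by move: z a zB aI LE; rewrite {}nE => z a *; exists z, a.
Qed.

(** Comparing coordinates in [L x = c *: x], each nonzero coordinate forces [a i = c], so by
    injectivity of [a] only one survives. This controls the arbitrary eigenbases allowed by
    [operator_equivalent]. *)
Lemma diagonal_eigenvector (n : nat) (L : 'End(g)) (z : n.-tuple g)
    (a : 'I_n -> K) (x : g) (c : K) :
  basis_of fullv z -> injective a ->
  (forall i, L (tnth z i) = a i *: tnth z i) ->
  x != 0 -> L x = c *: x ->
  exists (i : 'I_n) (b : K), b != 0 /\ x = b *: tnth z i.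
Proof.
move=> zB aI LE x0 Lx.
have xE : x = \sum_i coord z i x *: z`_i by apply: coord_basis (memvf x).
have [i ci|c0] := pickP (fun i => coord z i x != 0); last first.
  case/eqP: x0; rewrite xE big1 // => i _.
  by have /negbFE/eqP-> := c0 i; rewrite scale0r.
exists i, (coord z i x); split=> //.
have coordL j : coord z j x * a j = c * coord z j x.
  have <- : coord z j (L x) = c * coord z j x by rewrite Lx linearZ.
  rewrite [in RHS]xE linear_sum.
  rewrite (eq_bigr (fun k => (coord z k x * a k) *: z`_k)) => [|k _].
    by rewrite coord_sum_free // (basis_free zB).
  by rewrite linearZ /= -tnth_nth LE scalerA.
have ai : a i = c by apply: (mulfI ci); rewrite coordL mulrC.
rewrite [LHS]xE (bigD1 i) //= big1 ?addr0 -?tnth_nth // => j ji.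
have [->|cj] := eqVneq (coord z j x) 0; first by rewrite scale0r.
case/eqP: ji; apply: aI; rewrite ai.
by apply: (mulfI cj); rewrite coordL mulrC.
Qed.

End Diagonal.

(** Characteristic zero, which makes the eigenvalues 0, 1, 2 chosen later pairwise distinct. *)
Lemma real_or_complex_natr_inj (R : realType) (K : fieldType) :
  real_or_complex R K -> injective (fun n : nat => n%:R : K).
Proof.
case=> m n.
- by move=> /(@Num.Theory.mulrIn R _ (oner_neq0 _)).
- by move=> /(@Num.Theory.mulrIn (complex R) _ (oner_neq0 _)).
Qed.

(** On the span of [eta2] and [eta3] the bracket is zero and [lie eta1] is the identity. For
    [x = p *: eta1 + u] and [y = q *: eta1 + v] with [u], [v] in this span, the bracket is
    [p *: v - q *: u], which equals [p *: y - q *: x] as the multiples of [eta1] cancel. *)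
Lemma lie_coord_eta1 (K : fieldType) (g : lieAlgType K) (eta1 eta2 eta3 : g) :
  basis_of fullv [:: eta1; eta2; eta3] ->
  [lie eta1, eta2] = eta2 -> [lie eta3, eta1] = - eta3 ->
  [lie eta2, eta3] = 0 ->
  scalar_lie (coord [tuple eta1; eta2; eta3] ord0).
Proof.
move=> etaB l12 l31 l23.
have lieC (x y : g) : [lie x, y] = - [lie y, x].
  apply/eqP; rewrite -addr_eq0; apply/eqP.
  by have := liexx (x + y); rewrite lieDl !lieDr !liexx add0r addr0.
set t := [tuple _; _; _].
have split_eta x : exists u, [/\ x = coord t ord0 x *: eta1 + u,
    [lie eta1, u] = u & exists b c, u = b *: eta2 + c *: eta3].
  have etaB' : basis_of fullv t by [].
  have := coord_basis etaB' (memvf x).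
  rewrite !big_ord_recl big_ord0 addr0 /= => xE.
  eexists; split; [exact: xE | | by eexists; eexists].
  by rewrite lieDr !lieZr l12 [ [lie eta1, eta3] ]lieC l31 opprK.
move=> x y /=.
have [u [xE l1u [b [c uE]]]] := split_eta x.
have [v [yE l1v [d [e vE]]]] := split_eta y.
have luv : [lie u, v] = 0.
  rewrite uE vE !(lieDl, lieDr, lieZl, lieZr) !liexx l23.
  by rewrite [ [lie eta3, eta2] ]lieC l23 oppr0 !scaler0 !addr0.
(* The coordinates are generalized first because [x] and [y] also occur inside them. *)
move: (coord t ord0 x : K) (coord t ord0 y : K) xE yE => p q -> ->.
rewrite !(lieDl, lieDr, lieZl, lieZr) liexx luv l1v [ [lie u, _] ]lieC l1u.
rewrite !scaler0 addr0 add0r !scalerDr !scalerA (mulrC q p) scalerN.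
by rewrite opprD addrACA subrr add0r.
Qed.

Theorem mainTheorem6 (R : realType) (K : fieldType)
    (hK : real_or_complex R K) (g : lieAlgType K) (eta1 eta2 eta3 : g)
    (eta_basis : basis_of fullv [:: eta1; eta2; eta3])
    (lie12 : [lie eta1, eta2] = eta2)
    (lie31 : [lie eta3, eta1] = - eta3)
    (lie23 : [lie eta2, eta3] = 0) :
  [/\ forall z : 3.-tuple g, basis_of fullv z -> nijenhuis_eigenbasis z,
      exists z z' : 3.-tuple g,
        [/\ nijenhuis_eigenbasis z, nijenhuis_eigenbasis z'
          & forall s : 'S_3,
              ~ basis_equivalent z [tuple tnth z' (s i) | i < 3]]
    & exists L L' : 'End(g),
        [/\ algebraic_nijenhuis L /\ regular_semisimple L,
            algebraic_nijenhuis L' /\ regular_semisimple L'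
          & ~ operator_equivalent L L']].
Proof.
set t := [tuple eta1; eta2; eta3].
have tB : basis_of fullv t by [].
have lieE := lie_coord_eta1 eta_basis lie12 lie31 lie23.
set phi : {scalar g} := coord _ _ in lieE.
have phiE (i : 'I_3) : phi t`_i = (i == ord0)%:R.
  exact: coord_free (basis_free tB).
have phi1 : phi eta1 = 1 by have := phiE ord0.
have phi2 : phi eta2 = 0 by have := phiE (inord 1); rewrite -val_eqE /= inordK.
have phi3 : phi eta3 = 0 by have := phiE (inord 2); rewrite -val_eqE /= inordK.
pose t' := [tuple eta1; eta2 + eta1; eta3 + eta1].
have t'B : basis_of fullv t'.
  rewrite basisEdim (size_basis tB) leqnn andbT -(span_basis tB).
  have in_t' x : x \in tval t' -> x \in <<t'>>%VS by apply: memv_span.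
  apply/span_subvP => x; rewrite !inE => /or3P[] /eqP->.
  - by rewrite in_t' // !inE eqxx.
  - by rewrite -(addrK eta1 eta2) memvB ?in_t' // !inE eqxx ?orbT.
  - by rewrite -(addrK eta1 eta3) memvB ?in_t' // !inE eqxx ?orbT.
have phit' i : phi (tnth t' i) = 1.
  have : tnth t' i \in tval t' by apply: mem_tnth.
  by rewrite !inE => /or3P[] /eqP->; rewrite ?linearD /= ?phi2 ?phi3 ?add0r.
split=> [z||]; first exact: scalar_lie_eigenbasis lieE _ _.
  exists t, t'; split; try exact: scalar_lie_eigenbasis lieE _ _ _.
  (* Index 1 is [eta2], where [phi] is 0; whatever [s] is, its partner lies in [t'], where [phi] is
     1. *)
  move=> s /(basis_equivalent_scalar_eq0 lieE (i := inord 1)).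
  rewrite tnth_mktuple phit' (tnth_nth 0) inordK //= => /(_ phi2)/eqP.
  by rewrite oner_eq0.
pose a (i : 'I_3) : K := i%:R.
have aI : injective a by move=> i j /(real_or_complex_natr_inj hK)/val_inj.
have [L LE] := diagonal_operator_exists a tB.
have [L' L'E] := diagonal_operator_exists a t'B.
exists L, L'; split.
- split; first exact: scalar_lie_nijenhuis lieE L.
  exact: diagonal_regular_semisimple tB aI LE.
- split; first exact: scalar_lie_nijenhuis lieE L'.
  exact: diagonal_regular_semisimple t'B aI L'E.
move=> [z [z' [[zB zL] [z'B z'L] zz']]].
have dim3 : \dim {:g} = 3 by rewrite (size_basis tB).
have basis_neq0 (w : (\dim {:g}).-tuple g) i :
    basis_of fullv w -> tnth w i != 0.
  by move=> /basis_not0; apply; apply: mem_tnth.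
(* A zero of [phi] in [z] would pass to [z'], whose vectors are nonzero multiples of vectors of
   [t']. *)
have phiz i : phi (tnth z i) != 0.
  apply: contraT; rewrite negbK => /eqP /(basis_equivalent_scalar_eq0 lieE zz').
  have [c z'c] := z'L i.
  have [j [b [b0 ->]]] := diagonal_eigenvector t'B aI L'E (basis_neq0 _ i z'B) z'c.
  by rewrite linearZ /= phit' mulr1 => /eqP; rewrite (negPf b0).
(* Eigenvectors of [L] are multiples of vectors of [t], and only [eta1] has nonzero [phi]. Thus the
   whole basis [z] would lie on one line. *)
have z_line i : tnth z i \in <[eta1]>%VS.
  have [c zc] := zL i; have := phiz i.
  have [j [b [b0 ->]]] := diagonal_eigenvector tB aI LE (basis_neq0 _ i zB) zc.
  rewrite linearZ /= (tnth_nth 0) phiE.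
  by have [->|] := eqVneq j ord0; rewrite ?mulr0 ?eqxx // memvZ ?memv_line.
have /dimvS : (fullv <= <[eta1]>)%VS.
  by rewrite -(span_basis zB); apply/span_subvP => _ /tnthP[i ->].
(* The dimension of [<[eta1]>] is the boolean [eta1 != 0] read as 0 or 1, below 3 in both cases. *)
by rewrite dim3 dim_vline; case: (_ == _).
Qed.
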